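(* (Second variation of polarity.) Let $u(t,x)\in C^2(\mathbb R\times(\mathbb R^n\setminus\{0\}))$ with $u_t(\cdot)=u(t,\cdot)\in\mathcal S_2(\mathbb R^n)$ for each $t$. Let $w_t=w(t,\cdot)=(u_t)^\circ$ be the fiberwise polar. Then for every $t$ and $y$ such that $w_t$ is not linear on $[0,y]$, $$\left(\frac{\partial^2}{\partial t^2}\log w\right)(t,y)=-\frac{\partial^2}{\partial t^2}\log u+u\left\langle\nabla\frac{\partial}{\partial t}(\log u),(\nabla^2u)^{-1}\nabla\frac{\partial}{\partial t}(\log u)\right\rangle,$$ where the right hand side is evaluated at $(t,\nabla^\circ w_t(y))$. Equivalently, $$\frac{\ddot w}{w}\Big|_{(t,y)}=-\frac{1}{u\,\det\nabla_x^2u}\det\begin{pmatrix}-u^2\,\ddot{(1/u)}&u\nabla(\dot u/u)\\(u\nabla(\dot u/u))^T&\nabla_x^2u\end{pmatrix}\bigg|_{(t,\nabla^\circ w_t(y))}.$$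
   Context: Dots denote $\partial/\partial t$; $\ddot{(1/u)}=\partial^2(1/u)/\partial t^2$; $\nabla$, $\nabla^2=\nabla_x^2$ and $\nabla^\circ$ are taken in the space variable. In the $(n+1)\times(n+1)$ block matrix, $\nabla(\dot u/u)$ is a row vector. $\mathrm{Cvx}_0(\mathbb R^n)$ is the set of convex lower semi-continuous $f:\mathbb R^n\to[0,+\infty]$ with $f(0)=0$; $\mathrm{dom}(f)=\{f<\infty\}$. The polar of $f$ is $f^\circ(y)=\inf\{c\ge0:\langle x,y\rangle\le1+cf(x)\ \forall x\in\mathbb R^n\}$. $\mathcal S_1(\mathbb R^n)$ is the class of $f\in\mathrm{Cvx}_0(\mathbb R^n)$ that are finite everywhere, continuously differentiable on $\mathbb R^n\setminus\{0\}$ and strictly convex (the graph contains no segment). $\mathcal S_2(\mathbb R^n)\subset\mathcal S_1(\mathbb R^n)$ is the subclass of functions twice continuously differentiable on $\mathbb R^n\setminus\{0\}$ with $\nabla^2f(x)>0$ for all $x\ne0$. The polar subdifferential at $x\in\mathrm{dom}(f)$ is $\partial^\circ f(x)=\{y\in\mathrm{dom}(f^\circ): f^\circ(y)f(x)=\langle x,y\rangle-1\}$; if it is a single point $\{y\}$, $f$ is called polar differentiable at $x$ and $\nabla^\circ f(x)=y$. ($\nabla^\circ w_t(y)$ exists for the $y$ considered.) A function $g$ is linear on $[0,v]$ if it is finite there and $g(sv)=s\,g(v)$ for all $s\in[0,1]$. *)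

(* Defs.v *)
From HB Require Import structures.
From mathcomp Require Import all_boot all_order all_algebra.
From mathcomp Require Import all_classical all_reals all_analysis.
Import Order.TTheory GRing.Theory Num.Theory.
Import numFieldNormedType.Exports.

Set Implicit Arguments.
Unset Strict Implicit.
Unset Printing Implicit Defensive.

Local Open Scope classical_set_scope.
Local Open Scope ring_scope.

(* For an open set A of a finite-dimensional space V, continuity of all
   directional derivatives x |-> 'D_v f x is continuity of x |-> 'd f x. *)
Definition C1_on (R : realType) (V : normedModType R) (A : set V)
    (f : V -> R) : Prop :=
  forall x, A x ->
    differentiable f x /\ (forall v : V, {for x, continuous ('D_v f)}).

Definition C2_on (R : realType) (V : normedModType R) (A : set V)
    (f : V -> R) : Prop :=
  C1_on A f /\ (forall v : V, C1_on A ('D_v f)).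

Definition twice_derivable (R : realType) (f : R -> R) (t : R) : Prop :=
  (\forall s \near t, derivable f s 1) /\ derivable (derive1 f) t 1.

Section EuclideanSpace.
Variables (R : realType) (n : nat).
Implicit Types (x y v : 'rV[R]_n) (f g : 'rV[R]_n -> \bar R).
Implicit Types h : 'rV[R]_n -> R.

Definition dot x y : R := (x *m y^T) 0 0.

Definition grad h x : 'rV[R]_n := \row_i 'D_(delta_mx 0 i) h x.

Definition hessian h x : 'M[R]_n :=
  \matrix_(i, j) 'D_(delta_mx 0 i) ('D_(delta_mx 0 j) h) x.

Definition posdef (H : 'M[R]_n) : Prop :=
  forall v, v != 0 -> 0 < dot v (v *m H).

Definition dom f : set 'rV[R]_n := [set x | (f x < +oo)%E].

Definition convex f : Prop :=
  forall x y (s : R), 0 <= s <= 1 ->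
    (f (s *: x + (1 - s) *: y)%R <= s%:E * f x + (1 - s)%R%:E * f y)%E.

Definition strictly_convex f : Prop :=
  forall x y (s : R), x != y -> 0 < s < 1 ->
    (f (s *: x + (1 - s) *: y)%R < s%:E * f x + (1 - s)%R%:E * f y)%E.

Definition Cvx0 f : Prop :=
  [/\ convex f, lower_semicontinuous f, forall x, (0 <= f x)%E & f 0 = 0%E].

(* In \bar R, 0 * +oo = 0. Reading 0 * +oo as +oo instead can only change
   whether c = 0 itself is admissible, never the infimum. *)
Definition polar f y : \bar R :=
  ereal_inf [set c%:E | c in [set c : R |
    0 <= c /\ forall x, ((dot x y)%:E <= 1 + c%:E * f x)%E]].

Definition polar_subdiff f x : set 'rV[R]_n :=
  [set y | dom (polar f) y /\ (polar f y * f x)%E = (dot x y - 1)%:E].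

Definition polar_differentiable f x : Prop :=
  dom f x /\ exists y, polar_subdiff f x = [set y].

(* The polar gradient where f is polar differentiable; arbitrary elsewhere. *)
Definition polar_grad f x : 'rV[R]_n := xget 0 (polar_subdiff f x).

Definition S1 f : Prop :=
  [/\ Cvx0 f,
      forall x, f x \is a fin_num,
      C1_on [set x | x != 0] (fine \o f) &
      strictly_convex f].

Definition S2 f : Prop :=
  [/\ S1 f,
      C2_on [set x | x != 0] (fine \o f) &
      forall x, x != 0 -> posdef (hessian (fine \o f) x)].

Definition linear_on_segment g v : Prop :=
  forall s : R, 0 <= s <= 1 ->
    g (s *: v) \is a fin_num /\ g (s *: v) = (s%:E * g v)%E.

End EuclideanSpace.

(* Main.v *)
Require Import Defs.
From HB Require Import structures.
From mathcomp Require Import all_boot all_order all_algebra.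
From mathcomp Require Import all_classical all_reals all_analysis.
From mathcomp Require Import ring lra.
Import Order.TTheory GRing.Theory Num.Theory.
Import numFieldNormedType.Exports.
Local Open Scope classical_set_scope.
Local Open Scope ring_scope.

Set Implicit Arguments.
Unset Strict Implicit.
Unset Printing Implicit Defensive.

(* For fixed [t], [w_t y] is the supremum of [(<x, y> - 1) / u_t x]. If it is not
   attained, a maximizing sequence escapes to infinity, where the [- 1] is
   negligible, and [w_t] is linear on [[0, y]]. Otherwise strict convexity makes
   the maximizer [X t] unique, it persists for nearby times and depends
   continuously on them, and [X t] is the polar gradient. Differentiating the
   Euler equation [(<x, y> - 1) grad u = u y] along [X], where the rank-one terms
   of the linearization cancel, gives
   [X' = - u (hess u)^-1 grad (d/dt log u)]. By the envelope theorem
   [d/dt log w = - (d/dt log u) (t, X t)], and one more derivative yields the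
   formula; the determinant form is its Schur complement. *)

(** * The Euclidean pairing and compact annuli in row-vector space *)

Section Dot.
Variables (R : realType) (n : nat).
Implicit Types x y z : 'rV[R]_n.

Lemma dotE x y : dot x y = \sum_i x 0 i * y 0 i.
Proof. by rewrite /dot mxE; apply: eq_bigr => i _; rewrite mxE. Qed.

Lemma dotC x y : dot x y = dot y x.
Proof. by rewrite !dotE; apply: eq_bigr => i _; rewrite mulrC. Qed.

Lemma dotDl x y z : dot (x + y) z = dot x z + dot y z.
Proof. by rewrite /dot mulmxDl mxE. Qed.

Lemma dotZl (a : R) x y : dot (a *: x) y = a * dot x y.
Proof. by rewrite /dot -scalemxAl mxE. Qed.

Lemma dotZr (a : R) x y : dot x (a *: y) = a * dot x y.
Proof. by rewrite dotC dotZl dotC. Qed.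

Lemma dotBl x y z : dot (x - y) z = dot x z - dot y z.
Proof. by rewrite /dot mulmxBl !mxE. Qed.

Lemma dot0l y : dot 0 y = 0.
Proof. by rewrite /dot mul0mx mxE. Qed.

Lemma dot0r y : dot y 0 = 0.
Proof. by rewrite dotC dot0l. Qed.

Lemma dot_deltal i y : dot (delta_mx 0 i) y = y 0 i.
Proof.
rewrite dotE (bigD1 i)//= mxE !eqxx mul1r big1 ?addr0// => j ji.
by rewrite mxE (negbTE ji) andbF mul0r.
Qed.

Lemma le_coord_norm x i : `|x 0 i| <= `|x|.
Proof.
rewrite [leRHS]/Num.Def.normr/= mx_normrE.
exact: (le_bigmax _ (fun k : 'I_1 * 'I_n => `|x k.1 k.2|) (0, i)).
Qed.

Lemma dot_le_norm x y : dot x y <= (\sum_i `|y 0 i|) * `|x|.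
Proof.
rewrite dotE mulr_suml; apply: ler_sum => i _; apply: le_trans (ler_norm _) _.
by rewrite normrM mulrC ler_wpM2l// le_coord_norm.
Qed.

Lemma continuous_dotl y : continuous (fun z => dot z y).
Proof.
move=> x.
have e : (fun z => dot z y) = \sum_i (fun z : 'rV[R]_n => z 0 i * y 0 i).
  by apply/funext => z; rewrite dotE fct_sumE.
apply: differentiable_continuous; rewrite e; apply: differentiable_sum => i.
by apply: differentiableM; [exact: differentiable_coord|exact: differentiable_cst].
Qed.

(** Heine-Borel for the sets on which compactness is used below: [a = b] gives a sphere and [a = 0]
    a closed ball. *)
Lemma compact_annulus x (a b : R) : compact [set z : 'rV[R]_n | a <= `|z - x| <= b].
Proof.
apply: bounded_closed_compact.
  exists (b + `|x|); split; first exact: num_real.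
  move=> M bM z /= /andP[_ zb]; apply: le_trans (ltW bM).
  by rewrite -[z](subrK x) (le_trans (ler_normD _ _))// lerD2r.
have -> : [set z : 'rV[R]_n | a <= `|z - x| <= b] =
    (fun z : 'rV[R]_n => `|z - x|) @^-1` `[a, b]%classic.
  by apply/seteqP; split=> z /=; rewrite in_itv.
apply: closed_comp; last exact: itv_closed.
move=> z _; apply: continuous_comp; last exact: norm_continuous.
by apply: (@continuousB R _ _ id (cst x)); [exact: cvg_id|exact: cst_continuous].
Qed.

Lemma compact_annulus0 (a b : R) : compact [set z : 'rV[R]_n | a <= `|z| <= b].
Proof.
have -> : [set z : 'rV[R]_n | a <= `|z| <= b] =
    [set z : 'rV[R]_n | a <= `|z - 0| <= b].
  by apply/seteqP; split=> z /=; rewrite subr0.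
exact: compact_annulus.
Qed.

End Dot.

(** * Admissible constants and touching points for the polar of a finite function *)

Section Polar.
Variables (R : realType) (n : nat).
Implicit Types (x y z : 'rV[R]_n) (g : 'rV[R]_n -> R).

(** The admissible set of [polar], moved from [\bar R] to [R] for a real-valued [g]. *)
Definition polar_bound g y (c : R) : Prop :=
  0 <= c /\ forall x, dot x y <= 1 + c * g x.

Lemma polar_EFinE g y :
  polar (EFin \o g) y = ereal_inf (EFin @` polar_bound g y).
Proof.
by congr (ereal_inf (EFin @` _)); apply/seteqP; split=> c [c0 h]; split.
Qed.

Lemma polar_ge0 g y : (0 <= polar (EFin \o g) y)%E.
Proof.
by rewrite polar_EFinE; apply: le_ereal_inf_tmp => _ [c [c0 _] <-]; rewrite lee_fin.
Qed.

Lemma polar_le g y c : polar_bound g y c -> (polar (EFin \o g) y <= c%:E)%E.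
Proof. by move=> h; rewrite polar_EFinE; apply: ereal_inf_lbound; exists c. Qed.

Lemma polar_fin_num g y c : polar_bound g y c ->
  polar (EFin \o g) y \is a fin_num.
Proof.
move=> /polar_le h; rewrite ge0_fin_numE ?polar_ge0//.
by rewrite (le_lt_trans h)// ltry.
Qed.

(** The admissible constants form a closed set, so a finite infimum is itself admissible. *)
Lemma polar_bound_fine g y : (forall x, 0 <= g x) ->
  polar (EFin \o g) y \is a fin_num ->
  polar_bound g y (fine (polar (EFin \o g) y)).
Proof.
move=> g0 pf; split; first exact/fine_ge0/polar_ge0.
move=> x; apply/ler_addgt0Pr => e e0.
(* The [+ 1] keeps the denominator positive when [g x = 0], and [d * g x <= e] still holds. *)
pose d := e / (g x + 1).
have gx1 : 0 < g x + 1 by rewrite ltr_wpDl.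
have d0 : 0 < d by rewrite divr_gt0.
have : (polar (EFin \o g) y < (fine (polar (EFin \o g) y) + d)%:E)%E.
  by rewrite EFinD fineK// lteDl// lte_fin.
rewrite {1}polar_EFinE => /ereal_inf_lt[_ [c [c0 hc] <-]].
rewrite lte_fin => cd; apply: le_trans (hc x) _; rewrite -addrA lerD2l.
apply: le_trans (ler_wpM2r (g0 x) (ltW cd)) _.
rewrite mulrDl lerD2l /d -mulrA ler_piMr ?(ltW e0)//.
by rewrite ler_pdivrMl// mulr1 lerDl.
Qed.

(* [(x, c)] with [c > 0] touches when the supremum of
   [(<z, y> - 1) / g z] over [z] is [c] and is attained at [z = x]. *)
Definition touching g y x (c : R) : Prop :=
  [/\ 0 < c, forall z, dot z y <= 1 + c * g z & dot x y = 1 + c * g x].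

Lemma touching_neq0 g y x c : (forall z, 0 <= g z) -> touching g y x c -> x != 0.
Proof.
move=> g0 [c0 _ e]; apply/eqP => x0.
have := mulr_ge0 (ltW c0) (g0 x); move: e; rewrite {1}x0 dot0l; lra.
Qed.

(** No smaller constant is admissible: the constraint at [x] is tight for [c], and [g x] is
    positive. *)
Lemma polar_touching g y x c : 0 < g x -> touching g y x c ->
  polar (EFin \o g) y = c%:E.
Proof.
move=> gx0 [c0 le e]; apply/eqP; rewrite eq_le polar_le ?andTb /=; last first.
  by split=> //; exact: ltW.
rewrite polar_EFinE; apply: le_ereal_inf_tmp => _ [d [_ hd] <-].
by rewrite lee_fin -(ler_pM2r gx0) -(lerD2l 1) -e.
Qed.

End Polar.

(** * Convexity, coercivity, bipolarity and attainment for a fixed [g] in [S1] *)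

Section S1Theory.
Variables (R : realType) (n : nat) (g : 'rV[R]_n -> R).
Hypothesis gS1 : S1 (EFin \o g).
Implicit Types (x y z : 'rV[R]_n) (r s : R).

Lemma S1_ge0 x : 0 <= g x.
Proof. by have [[_ _ /(_ x) + _] _ _ _] := gS1; rewrite /= lee_fin. Qed.

Lemma S1_0 : g 0 = 0.
Proof. by have [[_ _ _ [->]] _ _ _] := gS1. Qed.

Lemma S1_strict x y s : x != y -> 0 < s < 1 ->
  g (s *: x + (1 - s) *: y) < s * g x + (1 - s) * g y.
Proof.
move=> xy s01; have [_ _ _ /(_ x y s xy s01)] := gS1.
by rewrite /= -!EFinM -EFinD lte_fin.
Qed.

Lemma S1_convex x y s : 0 <= s <= 1 ->
  g (s *: x + (1 - s) *: y) <= s * g x + (1 - s) * g y.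
Proof.
move=> s01; have [[/(_ x y s s01) + _ _ _] _ _ _] := gS1.
by rewrite /= -!EFinM -EFinD lee_fin.
Qed.

Lemma S1_differentiable x : x != 0 -> differentiable g x.
Proof. by move=> x0; have [_ _ /(_ x x0)[d _] _] := gS1. Qed.

Lemma S1_gt0 x : x != 0 -> 0 < g x.
Proof.
move=> x0; have h : 0 < (2^-1 : R) < 1 by lra.
have := S1_strict x0 h; rewrite scaler0 addr0 S1_0 mulr0 addr0.
have := S1_ge0 (2^-1 *: x); lra.
Qed.

Lemma S1_scale_le x s : 0 <= s <= 1 -> g (s *: x) <= s * g x.
Proof.
move=> s01; have := S1_convex x 0 s01.
by rewrite scaler0 addr0 S1_0 mulr0 addr0.
Qed.

Lemma S1_continuous x : x != 0 -> {for x, continuous g}.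
Proof. by move=> x0; exact/differentiable_continuous/S1_differentiable. Qed.

Lemma S1_within_continuous (A : set 'rV[R]_n) : ~ A 0 -> {within A, continuous g}.
Proof.
move=> A0; apply: continuous_in_subspaceT => x /set_mem Ax.
by apply: S1_continuous; apply/eqP => x0; rewrite x0 in Ax.
Qed.

(** The minimum of [g] on the sphere of radius [r] is positive, and convexity along rays from the
    origin, where [g] vanishes, propagates it linearly outwards. *)
Lemma S1_coercive r : 0 < r ->
  exists2 k : R, 0 < k & forall x, r <= `|x| -> k * `|x| <= g x.
Proof.
move=> r0; pose A := [set x : 'rV[R]_n | r <= `|x| <= r].
have A0 : ~ A 0 by rewrite /A /= normr0; lra.
(* The sphere is empty only for [n = 0], where no [x] satisfies [r <= |x|]. *)
have [A_ne|A_e] := pselect (A !=set0); last first.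
  exists 1 => // x rx; exfalso; apply: A_e; exists ((r / `|x|) *: x).
  have x0 : 0 < `|x| by exact: lt_le_trans rx.
  rewrite /A /= normrZ gtr0_norm ?divr_gt0// -mulrA mulVf ?gt_eqF//.
  by rewrite mulr1 lexx.
have [x0 /set_mem Ax0 min] :=
  EVT_min_rV A_ne (@compact_annulus0 R n r r) (@S1_within_continuous A A0).
have gx0 : 0 < g x0.
  by apply: S1_gt0; apply/eqP => x00; rewrite x00 in Ax0.
exists (g x0 / r); first exact: divr_gt0.
move=> x rx; have xn0 : 0 < `|x| by exact: lt_le_trans rx.
have s01 : 0 <= r / `|x| <= 1.
  by rewrite divr_ge0 ?(ltW r0)//= ler_pdivrMr ?mul1r.
have : g x0 <= g ((r / `|x|) *: x).
  apply: min; apply/mem_set; rewrite /A /= normrZ gtr0_norm ?divr_gt0//.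
  by rewrite -mulrA mulVf ?gt_eqF// mulr1 lexx.
move=> /le_trans/(_ (S1_scale_le x s01)).
by rewrite mulrAC ler_pdivlMr// => h; rewrite mulrAC ler_pdivrMr// [leRHS]mulrC.
Qed.

(** Points near the origin never constrain the constant in [polar_bound]: there the summand [1]
    suffices. *)
Lemma dot_le1_near0 y : exists2 r : R, 0 < r & forall x, `|x| <= r -> dot x y <= 1.
Proof.
pose K := \sum_i `|y 0 i|.
have K0 : 0 <= K by apply: sumr_ge0.
exists (K + 1)^-1; first by rewrite invr_gt0 ltr_wpDl.
move=> x xr; apply: le_trans (dot_le_norm x y) _.
apply: le_trans (ler_wpM2l K0 xr) _.
by rewrite ler_pdivrMr ?mul1r ?lerDl// ltr_wpDl.
Qed.

(** Near the origin the [1] dominates the pairing; farther out the linear growth of [g] does. *)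
Lemma S1_polar_bound y : exists c, polar_bound g y c.
Proof.
have [r r0 hr] := dot_le1_near0 y; have [k k0 hk] := S1_coercive r0.
pose K := \sum_i `|y 0 i|.
have K0 : 0 <= K by apply: sumr_ge0.
have c0 : 0 <= K / k by rewrite divr_ge0// ltW.
exists (K / k); split=> // x; have [xr|/ltW rx] := leP `|x| r.
  by rewrite (le_trans (hr x xr))// lerDl mulr_ge0// S1_ge0.
apply: le_trans (dot_le_norm x y) _; rewrite -/K.
apply: (@le_trans _ _ (K / k * g x)); last by rewrite lerDr.
by rewrite -mulrA ler_wpM2l// ler_pdivlMl// hk.
Qed.

Lemma S1_polar_fin y : polar (EFin \o g) y \is a fin_num.
Proof. by have [c /polar_fin_num] := S1_polar_bound y. Qed.

Lemma S1_polar_boundP y : polar_bound g y (fine (polar (EFin \o g) y)).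
Proof. exact: polar_bound_fine S1_ge0 (S1_polar_fin y). Qed.

Lemma S1_polar_touching y x c : touching g y x c -> polar (EFin \o g) y = c%:E.
Proof.
by move=> h; exact: polar_touching (S1_gt0 (touching_neq0 S1_ge0 h)) h.
Qed.

(** At the midpoint of two distinct touching points, strict convexity would violate the touching
    inequality. *)
Lemma touching_unique y x x' c : touching g y x c -> touching g y x' c -> x = x'.
Proof.
move=> [c0 le e] [_ _ e']; apply/eqP; apply: contraT => xx'; exfalso.
have h : 0 < (2^-1 : R) < 1 by lra.
have := S1_strict xx' h; have := le (2^-1 *: x + (1 - 2^-1) *: x').
rewrite dotDl !dotZl e e'; set a := g (_ + _); set b := g x; set d := g x' => p q.
have : c * a < c * (2^-1 * b + (1 - 2^-1) * d) by rewrite ltr_pM2l.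
lra.
Qed.

Lemma dot_grad x v : x != 0 -> dot v (grad g x) = 'D_v g x.
Proof.
move=> x0; have d := S1_differentiable x0.
rewrite (deriveE v d) {2}(row_sum_delta v) linear_sum dotE.
by apply: eq_bigr => i _; rewrite linearZ mxE deriveE.
Qed.

(** By convexity the difference quotients towards [z] with step [h] in (0, 1] are at most
    [g z - g x]; hence the one-sided limit. *)
Lemma S1_tangent_le x z : x != 0 -> g x + dot (z - x) (grad g x) <= g z.
Proof.
move=> x0; rewrite dot_grad// -lerBrDl.
have d : derivable g x (z - x) by exact/diff_derivable/S1_differentiable.
have {}d : (h^-1 *: (g (h *: (z - x) + x) - g x) @[h --> 0^'+]) --> 'D_(z - x) g x.
  apply: cvg_trans d; apply: cvg_app; apply: within_subset.
  by move=> h /=; rewrite /= => /gt_eqF/negbT.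
apply: (cvgr_to_le d); near=> h.
have h0 : 0 < h by [].
have h1 : h <= 1 by near: h; exact: nbhs_right_le.
have -> : h *: (z - x) + x = h *: z + (1 - h) *: x.
  by rewrite scalerBr scalerBl scale1r -addrA (addrC (- _)).
rewrite [_ *: _]mulrC ler_pdivrMr//.
have := S1_convex z x (_ : 0 <= h <= 1); rewrite ltW//= => /(_ h1); lra.
Unshelve. all: by end_near. Qed.

(** Polarity is an involution on [g]; this turns polar subgradients of the polar into touching
    points of [g]. *)
Lemma S1_bipolar x : polar (polar (EFin \o g)) x = (g x)%:E.
Proof.
have [->|x0] := eqVneq x 0.
  rewrite S1_0; apply/eqP; rewrite eq_le; apply/andP; split.
    apply: ereal_inf_lbound; exists 0 => //; split=> // z.
    by rewrite dot0r mul0e adde0 lee_fin.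
  by apply: le_ereal_inf_tmp => _ [c [c0 _] <-]; rewrite lee_fin.
apply/eqP; rewrite eq_le; apply/andP; split.
  apply: ereal_inf_lbound; exists (g x) => //; split; first exact: S1_ge0.
  move=> z; rewrite -(fineK (S1_polar_fin z)) -EFinM -EFinD lee_fin dotC mulrC.
  by have [_] := S1_polar_boundP z; exact.
have gx0 := S1_gt0 x0.
(* The tangent hyperplane at [x] exhibits a point [d^-1 *: p] at which the
   supremum defining the polar is attained at [x]. *)
pose p := grad g x; pose d := dot x p - g x.
(* Strict convexity gives [g (x / 2) < g x / 2], while the tangent at [x] bounds [g (x / 2)] below
   by [g x - dot x p / 2]. *)
have d0 : 0 < d.
  have h : 0 < (2^-1 : R) < 1 by lra.
  have := S1_strict x0 h; rewrite scaler0 addr0 S1_0 mulr0 addr0.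
  have := S1_tangent_le (2^-1 *: x) x0; rewrite -/p dotBl dotZl /d; lra.
have t : touching g (d^-1 *: p) x d^-1.
  split; first by rewrite invr_gt0.
    move=> z; rewrite dotZr ler_pdivrMl// mulrDr mulr1 mulrA divff ?gt_eqF// mul1r.
    by have := S1_tangent_le z x0; rewrite -/p dotBl /d; lra.
  rewrite dotZr; apply: (mulfI (lt0r_neq0 d0)).
  by rewrite mulrDr mulr1 !mulrA divff ?lt0r_neq0// !mul1r /d; lra.
apply: le_ereal_inf_tmp => _ [c [c0 hc] <-]; rewrite lee_fin.
have := hc (d^-1 *: p); rewrite (S1_polar_touching t) -EFinM -EFinD lee_fin.
by case: t => d'0 _; rewrite dotC => ->; rewrite lerD2l mulrC ler_pM2r.
Qed.

(** By bipolarity, membership in the subdifferential is the equality case of [touching] with the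
    same [c], so uniqueness of the touching point applies. *)
Lemma S1_polar_subdiff y x c : touching g y x c ->
  polar_subdiff (polar (EFin \o g)) y = [set x].
Proof.
move=> t; apply/seteqP; split=> [z|_ ->]; rewrite /polar_subdiff /dom /=.
  rewrite S1_bipolar (S1_polar_touching t) -EFinM => -[_ [e]].
  apply/esym/(touching_unique t); case: t => c0 le _; split=> //.
  by rewrite mulrC e dotC; lra.
rewrite S1_bipolar (S1_polar_touching t) -EFinM ltry; split=> //.
by case: t => c0 _ e; rewrite dotC e mulrC addrAC subrr add0r.
Qed.

(** Failure of linearity at some [s] yields a slope [d / s] below [c] that controls [g] at infinity,
    so the supremum is approached only on a compact annulus and is attained there. *)
Lemma not_linear_touching y : ~ linear_on_segment (polar (EFin \o g)) y ->
  exists x, touching g y x (fine (polar (EFin \o g) y)).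
Proof.
move=> /existsNP[s /not_implyP[s01]].
rewrite S1_polar_fin => /not_andP[//|ne].
have [c0 hc] := S1_polar_boundP y; have [d0 hd] := S1_polar_boundP (s *: y).
set c := fine (polar _ y) in c0 hc *; set d := fine _ in d0 hd.
have c_min c' : polar_bound g y c' -> c <= c'.
  by move=> /polar_le; rewrite -(fineK (S1_polar_fin y)) lee_fin.
have /andP[s0 s1] := s01.
(* Since [s <= 1], [s * c] is admissible for [s *: y]; equality is excluded by the choice of [s]. *)
have dsc : d < s * c.
  rewrite lt_neqAle; apply/andP; split.
    apply/eqP => e; apply: ne.
    by rewrite -(fineK (S1_polar_fin (s *: y))) -(fineK (S1_polar_fin y)) -EFinM -e.
  rewrite -lee_fin fineK ?S1_polar_fin//; apply: polar_le; split.
    exact: mulr_ge0.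
  move=> x; rewrite dotZr -mulrA; have := ler_wpM2l s0 (hc x).
  by rewrite mulrDr mulr1; lra.
have {}s0 : 0 < s.
  by rewrite lt_neqAle s0 andbT eq_sym; apply/eqP => e; rewrite e mul0r ltNge d0 in dsc.
have [r r0 hr] := dot_le1_near0 y; have [k k0 hk] := S1_coercive r0.
(* Half the gap between [d / s] and [c], so that [c1] below is their midpoint. *)
pose e := (c - d / s) / 2.
have e0 : 0 < e by rewrite divr_gt0// subr_gt0 ltr_pdivrMr// [ltRHS]mulrC.
pose c1 := d / s + e.
have c1_ge0 : 0 <= c1 := addr_ge0 (divr_ge0 d0 (ltW s0)) (ltW e0).
have c1c : c1 < c by rewrite /c1 /e; move: e0; rewrite /e; lra.
(* Beyond radius [b] coercivity gives [s^-1 <= e * g x], which absorbs the constant term left by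
   dividing the bound for [s *: y] by [s]. *)
pose b := s^-1 / e / k.
have far x : r <= `|x| -> b <= `|x| -> dot x y <= 1 + c1 * g x.
  move=> rx bx; have : s^-1 <= e * g x.
    rewrite -ler_pdivrMl// mulrC; apply: le_trans (hk x rx).
    by move: bx; rewrite /b ler_pdivrMr// [`|x| * k]mulrC.
  have := hd x; rewrite dotZr -ler_pdivlMl// mulrDr mulr1 /c1 mulrDl.
  by rewrite mulrA (mulrC d); lra.
pose A := [set x : 'rV[R]_n | r <= `|x| <= b].
have A0 : ~ A 0 by rewrite /A /= normr0; lra.
have outside x : ~ A x -> dot x y <= 1 + c1 * g x.
  move=> Ax; have [xr|/ltW rx] := leP `|x| r.
    by rewrite (le_trans (hr x xr))// lerDl mulr_ge0// S1_ge0.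
  by apply: far => //; have [//|/ltW xb] := leP b `|x|; exfalso; apply: Ax; apply/andP.
have [A_ne|A_e] := pselect (A !=set0); last first.
  have : c <= c1; last by rewrite leNgt c1c.
  apply: c_min; split=> // x; apply: outside => Ax.
  by apply: A_e; exists x.
pose phi x := (dot x y - 1) / g x.
have phi_cont : {within A, continuous phi}.
  apply: continuous_in_subspaceT => x /set_mem Ax.
  have x0 : x != 0 by apply/eqP => x0; rewrite x0 in Ax.
  apply: (@continuousM R _ (fun x => dot x y - 1) (fun x => (g x)^-1)).
    apply: (@continuousB R _ _ (fun x => dot x y) (cst 1)); first exact: continuous_dotl.
    exact: cst_continuous.
  by apply: continuousV; [rewrite gt_eqF// S1_gt0|exact: S1_continuous].
have [x0 /set_mem Ax0 max] := EVT_max_rV A_ne (@compact_annulus0 R n r b) phi_cont.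
have gx0 x : A x -> 0 < g x.
  by move=> Ax; apply: S1_gt0; apply/eqP => x00; rewrite x00 in Ax.
(* [phi x0] works on [A] and [c1] outside it, so their maximum is admissible; as [c1 < c],
   minimality of [c] leaves only [phi x0]. *)
have c_phi : c <= phi x0.
  have : c <= Num.max c1 (phi x0); last by rewrite le_max leNgt c1c.
  apply: c_min; split=> [|x]; first by rewrite le_max c1_ge0.
  have [Ax|Ax] := pselect (A x); last first.
    apply: le_trans (outside x Ax) _; rewrite lerD2l ler_wpM2r ?S1_ge0//.
    by rewrite le_max lexx.
  rewrite -lerBlDl -ler_pdivrMr ?gx0// le_max (_ : _ <= phi x0) ?orbT//.
  exact/max/mem_set.
exists x0; split=> //; first exact: le_lt_trans c1_ge0 c1c.
apply/eqP; rewrite eq_le hc/= -lerBrDl.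
by move: c_phi; rewrite /phi ler_pdivlMr ?gx0.
Qed.

End S1Theory.

(** * Persistence of touching points under a change of time *)

Lemma continuous_pair (T U V : topologicalType) (f : T -> U) (g : T -> V) (x : T) :
  {for x, continuous f} -> {for x, continuous g} ->
  {for x, continuous (fun z => (f z, g z))}.
Proof.
move=> fc gc. 
exact: (cvg_pair fc gc).
Qed.

Section Persistence.
Variables (R : realType) (n : nat) (u : R -> 'rV[R]_n -> R).
Hypothesis uS1 : forall t, S1 (EFin \o u t).
Hypothesis uC : forall p : R * 'rV[R]_n, p.2 != 0 ->
  {for p, continuous (fun q : R * 'rV[R]_n => u q.1 q.2)}.

(* A zero of the convex function [c g - <., y> + 1] that is a local minimum
   is a global one. *)
Lemma local_touching (g : 'rV[R]_n -> R) y x c r : S1 (EFin \o g) -> 0 < r ->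
  0 < c -> dot x y = 1 + c * g x ->
  (forall z, `|z - x| <= r -> dot z y <= 1 + c * g z) -> touching g y x c.
Proof.
move=> gS1 r0 c0 e loc; split=> // z.
pose s := r / (r + `|z - x|).
have d0 : 0 < r + `|z - x| by rewrite ltr_wpDr.
have s0 : 0 < s by rewrite divr_gt0.
have s1 : s <= 1 by rewrite ler_pdivrMr// mul1r lerDl.
have /loc : `|s *: z + (1 - s) *: x - x| <= r.
  have -> : s *: z + (1 - s) *: x - x = s *: (z - x).
    by rewrite scalerBl scale1r scalerBr [x - _]addrC !addrA addrK.
  rewrite normrZ gtr0_norm// /s mulrAC ler_pdivrMr// ler_wpM2l ?(ltW r0)//.
  by rewrite lerDr ltW.
rewrite dotDl !dotZl e => h.
have s01 : 0 <= s <= 1 by rewrite ltW.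
have := ler_wpM2l (ltW c0) (S1_convex gS1 z x s01).
rewrite mulrDr => h'.
have : s * dot z y <= s * (1 + c * g z) by lra.
by rewrite ler_pM2l.
Qed.

(** At time [t] the ratio [phi] is strictly smaller on a sphere around [x] than at [x]. By
    compactness this survives for nearby times, so the maximum over the closed ball is interior,
    hence local, and convexity makes it global. *)
Lemma touching_near t y x c r : touching (u t) y x c -> 0 < r ->
  \forall s \near t, exists x' c', touching (u s) y x' c' /\ `|x' - x| < r.
Proof.
move=> tch r0; have x0 := touching_neq0 (S1_ge0 (uS1 t)) tch.
have [c0 le e] := tch.
(* The bound [|x| / 2] keeps the closed ball away from the origin, where [phi] would divide by
   zero. *)
pose d := Num.min r (`|x| / 2).
have xn0 : 0 < `|x| by rewrite normr_gt0.
have d0 : 0 < d by rewrite lt_min r0 divr_gt0.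
have ball_neq0 z : `|z - x| <= d -> z != 0.
  move=> zd; apply/eqP => z0; move: zd; rewrite z0 sub0r normrN le_min => /andP[_].
  lra.
pose phi s z := (dot z y - 1) / u s z.
have phi_cont (p : R * 'rV[R]_n) : p.2 != 0 ->
    {for p, continuous (fun q : R * 'rV[R]_n => phi q.1 q.2)}.
  move=> p0; apply: (@continuousM R _ (fun q => dot q.2 y - 1) (fun q => (u q.1 q.2)^-1)).
    apply: (@continuousB R _ _ (fun q => dot q.2 y) (cst 1)); last exact: cst_continuous.
    apply: (@continuous_comp _ _ _ snd (fun z => dot z y)); first exact: cvg_snd.
    exact: continuous_dotl.
  by apply: continuousV; [rewrite gt_eqF// (S1_gt0 (uS1 _))|exact: uC].
have phi_tx : phi t x = c.
  by rewrite /phi e addrAC subrr add0r mulfK// gt_eqF// (S1_gt0 (uS1 t)).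
have near_x : \forall s \near t, 0 < phi s x.
  have : {for t, continuous (phi ^~ x)}.
    apply: (@continuous_comp _ _ _ (fun s => (s, x)) (fun q => phi q.1 q.2)).
      by apply: continuous_pair; [exact: cvg_id|exact: cvg_cst].
    exact: phi_cont.
  by move=> /cvgr_gt; apply; rewrite phi_tx.
have near_sphere : \forall s \near t,
    [set z : 'rV[R]_n | d <= `|z - x| <= d] `<=` (fun z => phi s z < phi s x).
  have /compact_near_coveringP cov := @compact_annulus R n x d d.
  apply: (cov R (nbhs t) (fun s z => phi s z < phi s x)) => z.
  move=> /= zd; have zd' : `|z - x| <= d by case/andP: zd.
  have z0 := ball_neq0 _ zd'.
  have lt : phi t z < phi t x.
    have uz0 := S1_gt0 (uS1 t) z0.
    (* Equality would make [z] a second touching point at time [t]. *)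
    rewrite phi_tx lt_neqAle; apply/andP; split; last first.
      by rewrite /phi ler_pdivrMr// lerBlDl.
    apply/eqP => ez; have tz : touching (u t) y z c.
      by split=> //; rewrite -ez mulfVK ?gt_eqF// addrC subrK.
    by move: zd; rewrite (touching_unique (uS1 t) tz tch) subrr normr0; lra.
  pose h (q : 'rV[R]_n * R) := phi q.2 x - phi q.2 q.1.
  have hC : {for (z, t), continuous h}.
    apply: (@continuousB R _ _ (fun q => phi q.2 x) (fun q => phi q.2 q.1)).
      apply: (@continuous_comp _ _ _ (fun q : 'rV[R]_n * R => (q.2, x))
                (fun q => phi q.1 q.2)); last exact: phi_cont.
      by apply: continuous_pair; [exact: cvg_snd|exact: cvg_cst].
    apply: (@continuous_comp _ _ _ (fun q : 'rV[R]_n * R => (q.2, q.1))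
              (fun q => phi q.1 q.2)); last exact: phi_cont.
    by apply: continuous_pair; [exact: cvg_snd|exact: cvg_fst].
  have : 0 < h (z, t) by rewrite subr_gt0.
  move=> /(cvgr_gt _ hC); apply: filterS => q.
  by rewrite /h subr_gt0.
near=> s.
have phi_sx : 0 < phi s x by near: s.
have sph z : d <= `|z - x| <= d -> phi s z < phi s x.
  by move: z; near: s.
pose B := [set z : 'rV[R]_n | 0 <= `|z - x| <= d].
have Bx : B x by rewrite /B /= subrr normr0 lexx ltW.
have cB : {within B, continuous (phi s)}.
  apply: continuous_in_subspaceT => z /set_mem /= /andP[_ zd].
  apply: (@continuous_comp _ _ _ (fun z => (s, z)) (fun q => phi q.1 q.2)).
    by apply: continuous_pair; [exact: cst_continuous|exact: cvg_id].
  exact/phi_cont/ball_neq0.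
have [x' /set_mem Bx' max] :=
  EVT_max_rV (ex_intro B x Bx) (@compact_annulus R n x 0 d) cB.
have {}max z : `|z - x| <= d -> phi s z <= phi s x'.
  by move=> zd; apply: max; apply/mem_set; rewrite /B /= normr_ge0.
have x'd : `|x' - x| < d.
  have /andP[_ x'd] := Bx'; rewrite lt_neqAle x'd andbT; apply/eqP => e'.
  have := sph x'; rewrite e' lexx => /(_ isT); rewrite ltNge => /negP; apply.
  by apply: max; rewrite subrr normr0 ltW.
have x'0 : x' != 0 by exact/ball_neq0/ltW.
have c'0 : 0 < phi s x'.
  by apply: lt_le_trans phi_sx _; apply: max; rewrite subrr normr0 ltW.
exists x', (phi s x'); split; last by rewrite (lt_le_trans x'd)// ge_min lexx.
(* The ball of this radius around [x'] lies in the ball on which [x'] is maximal. *)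
have dr : 0 < d - `|x' - x| by rewrite subr_gt0.
apply: (local_touching (uS1 s) dr c'0).
  rewrite /phi mulfVK; first by rewrite addrC subrK.
  exact/lt0r_neq0/(S1_gt0 (uS1 s)).
move=> z zx'; have zd : `|z - x| <= d.
  by rewrite -(subrKA x') (le_trans (ler_normD _ _))// -lerBrDr.
have := max z zd; rewrite {1}/phi ler_pdivrMr ?(S1_gt0 (uS1 s)) ?ball_neq0//.
by rewrite lerBlDl.
Unshelve. all: by end_near. Qed.

End Persistence.

(** * Mean values along lines and symmetry of second derivatives *)

Section LineDerivative.
Variables (R : realType) (V : normedModType R).
Implicit Types (f : V -> R) (p q v w : V).

Lemma is_derive_line f q v (a : R) : derivable f (q + a *: v) v ->
  is_derive a 1 (fun s => f (q + s *: v)) ('D_v f (q + a *: v)).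
Proof.
have e : (fun h => h^-1 *: (((fun s : R => f (q + s *: v)) \o shift a) (h *: 1) -
      f (q + a *: v))) =
    (fun h : R => h^-1 *: ((f \o shift (q + a *: v)) (h *: v) - f (q + a *: v))).
  apply/funext => h /=; congr (_ *: (f _ - _)).
  by rewrite [h *: 1]mulr1 scalerDl addrCA.
by move=> d; split; [rewrite /derivable e|rewrite /derive e].
Qed.

Lemma mean_value (F dF : R -> R) (h : R) : 0 < h ->
  (forall a, 0 <= a <= h -> is_derive a 1 F (dF a)) ->
  exists2 a, 0 < a < h & F h - F 0 = dF a * h.
Proof.
move=> h0 d; have [||a] := @MVT R F dF 0 h h0.
- by move=> a; rewrite in_itv/= => /andP[a0 ah]; apply: d; rewrite !ltW.
- apply: derivable_within_continuous => a; rewrite in_itv/= => /d.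
  by case.
by rewrite in_itv/= subr0 => ah e; exists a.
Qed.

(** The mean value theorem in direction [v], applied to the increment in direction [w], and then
    once more in direction [w]. *)
Lemma second_difference f p v w (h : R) : 0 < h ->
  (forall a b, 0 <= a <= h -> 0 <= b <= h ->
    derivable f (p + a *: v + b *: w) v /\
    derivable ('D_v f) (p + a *: v + b *: w) w) ->
  exists a b, [/\ 0 <= a <= h, 0 <= b <= h &
    f (p + h *: v + h *: w) - f (p + h *: v) - (f (p + h *: w) - f p) =
    'D_w ('D_v f) (p + a *: v + b *: w) * h * h].
Proof.
move=> h0 d.
pose F (a : R) : R := f (p + h *: w + a *: v) - f (p + a *: v).
pose dF a := 'D_v f (p + h *: w + a *: v) - 'D_v f (p + a *: v).
have hh : 0 <= h <= h by rewrite lexx ltW.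
have h00 : 0 <= (0 : R) <= h by rewrite lexx ltW.
have [a ah|a /andP[a0 ah] e] := @mean_value F dF h h0.
  have [d1 _] := d a h ah hh; have [d0 _] := d a 0 ah h00.
  apply: is_deriveB.
    by apply: is_derive_line; rewrite addrAC.
  by rewrite scale0r addr0 in d0; exact: is_derive_line.
have ah' : 0 <= a <= h by rewrite !ltW.
have [b bh|b /andP[b0 bh] e'] := @mean_value
    (fun b => 'D_v f (p + a *: v + b *: w))
    (fun b => 'D_w ('D_v f) (p + a *: v + b *: w)) h h0.
  by apply: is_derive_line; have [] := d a b ah' bh.
exists a, b; split=> //; first by rewrite !ltW.
rewrite -e' scale0r addr0 [p + a *: v + _]addrAC -[LHS]/(_ - _).
by rewrite -/(dF a) -e /F !scale0r !addr0 [p + h *: w + _]addrAC.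
Qed.

(** Schwarz's theorem. The second difference over a small parallelogram is symmetric in [v] and [w],
    so the two mixed derivatives agree at a pair of points near [p]; continuity transfers this to
    [p]. *)
Lemma C2_on_symmetric (A : set V) f p v w : open A -> A p -> C2_on A f ->
  'D_w ('D_v f) p = 'D_v ('D_w f) p.
Proof.
move=> oA Ap [f1 f2].
have [F FE] : exists F : V -> R, F = 'D_w ('D_v f).
  by exists ('D_w ('D_v f)); reflexivity.
have [G GE] : exists G : V -> R, G = 'D_v ('D_w f).
  by exists ('D_v ('D_w f)); reflexivity.
suff : F p = G p by rewrite FE GE.
apply/eqP; rewrite -subr_eq0 -normr_le0.
apply/ler_addgt0Pr => e e0; rewrite add0r.
have e20 : 0 < e / 2 by rewrite divr_gt0.
have nearF : \forall z \near p, `|F p - F z| <= e / 2.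
  by have [_ /(_ w)] := f2 v p Ap; rewrite -FE => /cvgrPdist_le/(_ _ e20).
have nearG : \forall z \near p, `|G p - G z| <= e / 2.
  by have [_ /(_ v)] := f2 w p Ap; rewrite -GE => /cvgrPdist_le/(_ _ e20).
pose Q z := [/\ A z, `|F p - F z| <= e / 2 & `|G p - G z| <= e / 2].
have : \forall z \near p, Q z.
  near=> z; split; [|by near: z; exact: nearF|by near: z; exact: nearG].
  by near: z; exact: open_nbhs_nbhs.
move=> /nbhs_ballP[r /= r0 hr].
pose K := `|v| + `|w| + 1.
have K0 : 0 < K by rewrite ltr_wpDl// addr_ge0.
(* Small enough for the parallelogram with sides [h *: v] and [h *: w] to stay in the ball of radius
   [r]; the [+ 1] in [K] covers [v = w = 0]. *)
pose h := r / K / 2.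
have h0 : 0 < h by rewrite !divr_gt0.
have hQ (a b : R) : 0 <= a <= h -> 0 <= b <= h -> Q (p + a *: v + b *: w).
  move=> /andP[a0 ah] /andP[b0 bh]; apply: hr.
  rewrite -ball_normE /= -addrA opprD addrA subrr sub0r normrN.
  apply: le_lt_trans (ler_normD _ _) _; rewrite !normrZ !ger0_norm//.
  have : a * `|v| <= h * `|v| by rewrite ler_wpM2r.
  have : b * `|w| <= h * `|w| by rewrite ler_wpM2r.
  have : h * K < r.
    by rewrite /h mulrAC divfK ?gt_eqF// ltr_pdivrMr// mulr_natr mulr2n ltrDl.
  rewrite /K !mulrDr; lra.
have hQ' (a b : R) : 0 <= a <= h -> 0 <= b <= h -> Q (p + b *: w + a *: v).
  by move=> ah bh; rewrite addrAC; exact: hQ.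
have [x [Qx ex]] : exists x, Q x /\
    f (p + h *: v + h *: w) - f (p + h *: v) - (f (p + h *: w) - f p) = F x * h * h.
  rewrite FE; have [a b ah bh|a [b [ah bh e1]]] := @second_difference f p v w h h0.
    have [Az _ _] := hQ a b ah bh.
    by split; apply: diff_derivable; [have [] := f1 _ Az|have [] := f2 v _ Az].
  by exists (p + a *: v + b *: w); split; [exact: hQ|exact: e1].
have [y [Qy ey]] : exists y, Q y /\
    f (p + h *: w + h *: v) - f (p + h *: w) - (f (p + h *: v) - f p) = G y * h * h.
  rewrite GE; have [b a bh ah|b [a [bh ah e1]]] := @second_difference f p w v h h0.
    have [Az _ _] := hQ' a b ah bh.
    by split; apply: diff_derivable; [have [] := f1 _ Az|have [] := f2 w _ Az].
  by exists (p + b *: w + a *: v); split; [exact: hQ'|exact: e1].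
have Fxy : F x = G y.
  apply: (mulIf (lt0r_neq0 h0)); apply: (mulIf (lt0r_neq0 h0)).
  by rewrite -ex -ey [p + h *: w + _]addrAC; ring.
have [_ q1 _] := Qx; have [_ _ q2] := Qy.
rewrite -(subrKA (F x)) (le_trans (ler_normD _ _))// [e]splitr lerD//.
by rewrite Fxy distrC.
Unshelve. all: by end_near. Qed.

End LineDerivative.

(** * Differentiation of a continuous implicit curve *)

Section Implicit.
Variables (R : realType) (n : nat).

(** The curve [X] is given and continuous; only its derivative is sought. With the space part of the
    linearization normalized to the identity, the increment [d h] satisfies
    [h *: c + d h = o(|h| + |d h|)]. *)
Lemma implicit_derivable (F : 'I_n -> R * 'rV[R]_n -> R) (X : R -> 'rV[R]_n)
    (t : R) (c : 'rV[R]_n) :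
  (forall j, differentiable (F j) (t, X t)) ->
  (forall j h d, 'd (F j) (t, X t) (h, d) = h * c 0 j + d 0 j) ->
  (\forall s \near t, forall j, F j (s, X s) = 0) ->
  {for t, continuous X} -> is_derive t 1 X (- c).
Proof.
move=> dF dFE F0 XC.
pose d h := X (h + t) - X t.
have shiftC : h + t @[h --> (0 : R)] --> t.
  rewrite -[in X in _ --> X](add0r t); apply: cvgD; [exact: cvg_id|exact: cvg_cst].
have key e : 0 < e -> \forall h \near 0, `|h *: c + d h| <= e * (`|h| + `|d h|).
  move=> e0.
  have dC : (h, d h) @[h --> (0:R)] --> (0 : R, 0 : 'rV[R]_n).
    have d0 : d h @[h --> (0 : R)] --> (0 : 'rV[R]_n).
      rewrite -[in X in _ --> X](subrr (X t)).
      by apply: cvgB; [exact: cvg_comp shiftC XC|exact: cvg_cst].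
    exact: (cvg_pair (@cvg_id _ (nbhs (0 : R))) d0).
  have near_j : \forall q \near (0 : R, 0 : 'rV[R]_n), forall j,
      `|F j (q + (t, X t)) - F j (t, X t) - 'd (F j) (t, X t) q| <= e * `|q|.
    near=> q => j; move: j; near: q; apply: filter_forall => j.
    have /diff_locallyP[_ /eqaddoP /(_ e e0)] := dF j.
    by apply: filterS => q; rewrite [in X in X -> _]/GRing.add/= opprD addrA.
  have F0' : \forall h \near (0 : R), forall j, F j (h + t, X (h + t)) = 0.
    exact: shiftC F0.
  near=> h.
  have Fh : forall j, F j (h + t, X (h + t)) = 0 by near: h.
  have Ft : forall j, F j (t, X t) = 0 by exact: nbhs_singleton F0.
  have dh : forall j, `|F j ((h, d h) + (t, X t)) - F j (t, X t) -
      'd (F j) (t, X t) (h, d h)| <= e * `|(h, d h)|.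
    by near: h; exact: dC near_j.
  rewrite [leLHS]/Num.Def.normr/= mx_normrE bigmax_le//=.
    by rewrite mulr_ge0 ?(ltW e0)// addr_ge0.
  move=> [i j] _ /=.
  have -> : (h *: c + d h) i j = h * c 0 j + d h 0 j.
    by rewrite ord1 [LHS]mxE [X in X + _]mxE.
  have := dh j; rewrite dFE Ft subr0 (_ : (h, d h) + (t, X t) = (h + t, X (h + t))).
    rewrite Fh sub0r normrN => /le_trans; apply.
    rewrite ler_wpM2l ?(ltW e0)// prod_normE ge_max/=.
    by rewrite lerDl lerDr !normr_ge0.
  by congr (_, _); rewrite /d subrK.
(* The choice [e = 1/2] lets the left side absorb [|d h|], giving a Lipschitz bound at [t]. *)
have lip : \forall h \near 0, `|d h| <= (2 * `|c| + 1) * `|h|.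
  have h2 : 0 < (2^-1 : R) by [].
  have := key _ h2; apply: filterS => h.
  have : `|d h| <= `|h *: c + d h| + `|h| * `|c|.
    rewrite -normrZ -[d h in leLHS](addKr (h *: c)) addrC.
    by rewrite (le_trans (ler_normD _ _))// normrN.
  lra.
have lim : h^-1 *: ((X \o shift t) (h *: 1) - X t) @[h --> 0^'] --> - c.
  apply/cvgrPdist_le => e e0.
  pose K := 2 * `|c| + 2.
  have K0 : 0 < K by rewrite ltr_wpDl// mulr_ge0.
  have eK : 0 < e / K by rewrite divr_gt0.
  near=> h.
  have h0 : h != 0 by near: h; exact: nbhs_dnbhs_neq.
  have l : `|d h| <= (2 * `|c| + 1) * `|h|.
    by near: h; exact: nbhs_dnbhs.
  have k : `|h *: c + d h| <= e / K * (`|h| + `|d h|).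
    by near: h; exact/nbhs_dnbhs/key.
  rewrite /= [h *: 1]mulr1 -/(d h).
  rewrite -opprD normrN -[c](scalerK h0) -scalerDr normrZ normfV.
  rewrite ler_pdivrMl ?normr_gt0//; apply: le_trans k _.
  have hK : `|h| + `|d h| <= K * `|h| by rewrite /K; lra.
  apply: le_trans (ler_wpM2l (ltW eK) hK) _.
  by rewrite mulrA divfK ?gt_eqF// mulrC.
by split; [apply/cvg_ex; exists (- c)|exact/cvg_lim].
Unshelve. all: by end_near. Qed.

End Implicit.

(** * Schur complement, first-order optimality and second derivatives *)

Lemma det_block_schur (R : comUnitRingType) m n (A : 'M[R]_m) (B : 'M[R]_(m, n))
    (C : 'M[R]_(n, m)) (D : 'M[R]_n) : D \in unitmx ->
  \det (block_mx A B C D) = \det (A - B *m invmx D *m C) * \det D.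
Proof.
move=> uD.
(* Block elimination: an upper triangular factor times a lower unitriangular one. *)
have -> : block_mx A B C D =
    block_mx (A - B *m invmx D *m C) B 0 D *m block_mx 1%:M 0 (invmx D *m C) 1%:M.
  rewrite mulmx_block !mulmx1 !mulmx0 !add0r mulmxA subrK.
  by rewrite mulmxA mulmxV// mul1mx.
by rewrite det_mulmx det_ublock det_lblock !det1 !mulr1.
Qed.

(** First-order condition at the zero minimum of [c g - <., y> + 1]: one-sided quotients give an
    inequality in every direction, and opposite directions give equality. *)
Lemma S1_touching_grad (R : realType) n (g : 'rV[R]_n -> R) y x c :
  S1 (EFin \o g) -> touching g y x c -> c *: grad g x = y.
Proof.
move=> gS1 t; have x0 := touching_neq0 (S1_ge0 gS1) t; have [c0 le e] := t.
have dg := S1_differentiable gS1 x0.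
have half v : dot v y <= c * 'D_v g x.
  rewrite mulrC -ler_pdivrMr//.
  have d : (h^-1 *: (g (h *: v + x) - g x) @[h --> 0^'+]) --> 'D_v g x.
    have dv : derivable g x v by exact: diff_derivable.
    apply: cvg_trans dv; apply: cvg_app; apply: within_subset.
    by move=> h /= /gt_eqF/negbT.
  apply: (cvgr_to_ge d); near=> h.
  have h0 : 0 < h by [].
  rewrite [_ *: _]mulrC ler_pdivlMr// mulrAC ler_pdivrMr//.
  by have := le (h *: v + x); rewrite dotDl dotZl e; lra.
apply/rowP => i; rewrite !mxE -[RHS]dot_deltal; apply/eqP; rewrite eq_le half andbT.
have := half (- delta_mx 0 i).
rewrite (deriveE _ dg) linearN -(deriveE _ dg) -scaleN1r dotZl mulrN mulN1r lerN2.
by [].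
Unshelve. all: by end_near. Qed.

Lemma posdef_unitmx (R : realType) n (H : 'M[R]_n) : posdef H -> H \in unitmx.
Proof.
move=> pH; rewrite -row_free_unit -kermx_eq0; apply/rowV0P => v /sub_kermxP vH.
by apply/eqP; apply: contraT => /pH; rewrite vH dot0r ltxx.
Qed.

Lemma twice_derivable_near (R : realType) (f g : R -> R) (t d : R) :
  (\forall s \near t, is_derive (s : R) (1 : R) f (g s)) ->
  is_derive (t : R) (1 : R) g d ->
  twice_derivable f t /\ derive1n 2 f t = d.
Proof.
move=> fg gd.
have e : \forall s \near t, g s = derive1 f s.
  by apply: filterS fg => s fs; rewrite derive1E derive_val.
have [d1 d2] := near_eq_is_derive e gd.
split; last by rewrite /= derive1E.
by split=> //; apply: filterS fg => s [].
Qed.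

(** * Time and space derivatives, and the chain rule along a curve *)

Section Partial.
Variables (R : realType) (n : nat).
Local Notation V := 'rV[R]_n.
Implicit Types (f : R * V -> R) (p : R * V).

Lemma is_derive_time f t x : differentiable f (t, x) ->
  is_derive t 1 (fun s => f (s, x)) ('D_(1, 0) f (t, x)).
Proof.
have e : (fun h => h^-1 *: (((fun s => f (s, x)) \o shift t) (h *: 1) - f (t, x))) =
    (fun h : R => h^-1 *: ((f \o shift (t, x)) (h *: (1, 0)) - f (t, x))).
  apply/funext => h /=; congr (_ *: (f _ - _)).
  by congr (_, _); rewrite /= scaler0 add0r.
move=> df; have d := @diff_derivable _ _ _ f (t, x) (1, 0) df.
by split; [rewrite /derivable e|rewrite /derive e].
Qed.

Lemma derive_space f t x v : 'D_v (fun z => f (t, z)) x = 'D_(0, v) f (t, x).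
Proof.
have e : (fun h => h^-1 *: (((fun z => f (t, z)) \o shift x) (h *: v) - f (t, x))) =
    (fun h : R => h^-1 *: ((f \o shift (t, x)) (h *: (0, v)) - f (t, x))).
  apply/funext => h /=; congr (_ *: (f _ - _)).
  by congr (_, _); rewrite /= scaler0 add0r.
by rewrite /derive e.
Qed.

Lemma derive_decomp f p (h : R) (d : V) : differentiable f p ->
  'D_(h, d) f p =
  h * 'D_(1, 0) f p + \sum_i d 0 i * 'D_(0, delta_mx 0 i) f p.
Proof.
move=> df; have -> : (h, d) = h *: (1, 0) + \sum_i d 0 i *: (0, delta_mx 0 i) :> R * V.
  have sE : (fun z : V => (0 : R, z)) d = \sum_i d 0 i *: (0, delta_mx 0 i).
    rewrite {1}(row_sum_delta d).
    rewrite (big_morph (id1 := 0) (op1 := +%R) (fun z : V => (0 : R, z))).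
    - by apply: eq_bigr => i _; congr (_, _); rewrite /= scaler0.
    - by move=> y z; congr (_, _); rewrite /= addr0.
    - by [].
  rewrite -sE [RHS]surjective_pairing /=; congr (_, _); last by rewrite scaler0 add0r.
  by rewrite addr0 [RHS]mulr1.
rewrite (deriveE _ df) linearD linear_sum linearZ -deriveE//.
by congr (_ + _); apply: eq_bigr => i _; rewrite linearZ -deriveE.
Qed.

Lemma is_derive_along f (X : R -> V) t X' : differentiable f (t, X t) ->
  is_derive t 1 X X' ->
  is_derive t 1 (fun s => f (s, X s)) ('D_(1, X') f (t, X t)).
Proof.
move=> df [dX eX]; have {}dX : differentiable X t by exact/derivable1_diffP.
have dp : differentiable (fun s => (s, X s)) t by exact: differentiable_pair.
have dc : differentiable (f \o (fun s => (s, X s))) t by exact: differentiable_comp.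
split; first exact: diff_derivable.
rewrite -[fun s => _]/(f \o (fun s => (s, X s))) deriveE// diff_comp//=.
by rewrite diff_pair//= diff_val /= -eX !deriveE.
Qed.

End Partial.

Lemma scaleE (R : realType) (a b : R) : a *: b = a * b.
Proof. by []. Qed.

Lemma open_neq0 (R : realType) n : open [set x : 'rV[R]_n | x != 0].
Proof.
rewrite (_ : [set _ | _] = (fun x : 'rV[R]_n => `|x|) @^-1` [set r | 0 < r]).
  by apply: open_comp; [move=> x _; exact: norm_continuous|exact: open_gt].
by apply/seteqP; split=> x /=; rewrite normr_gt0.
Qed.

Lemma near_neq0 (R : realType) n (x : 'rV[R]_n) : x != 0 -> \forall z \near x, z != 0.
Proof. by move=> x0; exact: (open_nbhs_nbhs (conj (@open_neq0 R n) x0)). Qed.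

Lemma is_diff_dot (R : realType) n (y : 'rV[R]_n) (p : R * 'rV[R]_n) :
  is_diff p (fun q : R * 'rV[R]_n => dot q.2 y - 1)
    (fun q => dot q.2 y).
Proof.
have lin : linear (fun q : R * 'rV[R]_n => dot q.2 y : R^o).
  by move=> a q r; rewrite dotDl dotZl.
pose fM := GRing.isLinear.Build _ _ _ _ _ lin.
pose f : {linear _ -> _} := HB.pack (fun q : R * 'rV[R]_n => dot q.2 y : R^o) fM.
have fc : continuous f.
  move=> q; apply: (@continuous_comp _ _ _ snd (fun z => dot z y)); first exact: cvg_snd.
  exact: continuous_dotl.
have d1 : is_diff p f f.
  by apply: DiffDef; [exact: linear_differentiable|exact: diff_lin].
apply: is_diff_eq (is_diffB d1 (is_diff_cst (1 : R) p)) _.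
by apply/funext => q; rewrite -[LHS]/(f q - 0) subr0.
Qed.

Lemma is_derive_dot (R : realType) n (y : 'rV[R]_n) (p : R * 'rV[R]_n)
    (h : R) (d : 'rV[R]_n) :
  is_derive p (h, d) (fun q : R * 'rV[R]_n => dot q.2 y - 1) (dot d y).
Proof.
have [dd e] := is_diff_dot y p; split; first exact: diff_derivable.
by rewrite deriveE// e.
Qed.

(** * Motion of the maximizer and variation of the polar for fixed [y] *)

Section Variation.
Variables (R : realType) (n : nat) (u : R -> 'rV[R]_n -> R).
Hypothesis uC2 : C2_on [set p : R * 'rV[R]_n | p.2 != 0] (fun p => u p.1 p.2).
Hypothesis uS2 : forall t, S2 (EFin \o u t).
Variable y : 'rV[R]_n.

Implicit Types (p : R * 'rV[R]_n) (s t : R) (x z : 'rV[R]_n).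

Definition joint p := u p.1 p.2.
Definition time_deriv := 'D_(1, 0) joint.
Definition space_deriv (j : 'I_n) := 'D_(0, delta_mx 0 j) joint.
Definition log_rate p := time_deriv p / joint p.
Definition grad_log_rate p : 'rV[R]_n := \row_i 'D_(0, delta_mx 0 i) log_rate p.
Definition polar_path s := fine (polar (EFin \o u s) y).
(** Defined at all times through [polar_grad], with value [0] where the subdifferential is empty; it
    is known to maximize only when [attained s]. *)
Definition maximizer s := polar_grad (polar (EFin \o u s)) y.
Definition attained s := touching (u s) y (maximizer s) (polar_path s).
Definition rate s := log_rate (s, maximizer s).

Local Notation U := joint.
Local Notation Ut := time_deriv.
Local Notation Ux := space_deriv.
Local Notation K := log_rate.
Local Notation dK := grad_log_rate.
Local Notation w s := (polar (EFin \o u s)).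
Local Notation wy := polar_path.
Local Notation X := maximizer.

Let uS1 t : S1 (EFin \o u t). Proof. by have [] := uS2 t. Qed.

Lemma joint_gt0 p : p.2 != 0 -> 0 < U p. Proof. exact: S1_gt0 (uS1 p.1) _. Qed.

Lemma joint_differentiable p : p.2 != 0 -> differentiable U p.
Proof. by move=> p0; have [/(_ p p0)[]] := uC2. Qed.

Lemma derive_joint_differentiable (v : R * 'rV[R]_n) p : p.2 != 0 ->
  differentiable ('D_v U) p.
Proof. by move=> p0; have [_ /(_ v p p0)[]] := uC2. Qed.

Lemma open_snd_neq0 : open [set p : R * 'rV[R]_n | p.2 != 0].
Proof.
rewrite (_ : [set _ | _] = snd @^-1` [set x : 'rV[R]_n | x != 0])//.
by apply: open_comp; [move=> p _; exact: cvg_snd|exact: open_neq0].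
Qed.

Lemma joint_continuous p : p.2 != 0 -> {for p, continuous U}.
Proof. by move=> p0; apply: differentiable_continuous; exact: joint_differentiable. Qed.

Lemma log_rate_differentiable p : p.2 != 0 -> differentiable K p.
Proof.
move=> p0; apply: differentiableM; first exact: derive_joint_differentiable.
by apply: differentiableV; [exact: joint_differentiable|exact/lt0r_neq0/joint_gt0].
Qed.

(** Quotient rule, with the mixed derivative of [U] put in the order in which it arises from
    differentiating [grad u] in time. *)
Lemma grad_log_rateE p i : p.2 != 0 ->
  dK p 0 i = 'D_(1, 0) (Ux i) p / U p - Ut p * Ux i p / U p ^+ 2.
Proof.
move=> p0; have U0 : U p != 0 by exact/lt0r_neq0/joint_gt0.
rewrite mxE /K.
have dUt := @diff_derivable _ _ _ Ut p (0, delta_mx 0 i)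
  (derive_joint_differentiable (1, 0) p0).
have dU := @diff_derivable _ _ _ U p (0, delta_mx 0 i) (joint_differentiable p0).
have dV := @derivableV _ _ U p (0, delta_mx 0 i) U0 dU.
rewrite (deriveM dUt dV) (deriveV U0 dU).
have e := @C2_on_symmetric R (R * 'rV[R]_n)%type _ U p (1, 0) (0, delta_mx 0 i)
  open_snd_neq0 p0 uC2.
rewrite e -/(Ux i) -/Ut -['D_(0, _) U p]/(Ux i p).
move: ('D_(1, 0) (Ux i) p) (Ut p) (Ux i p) (U p) U0 => a b c d d0.
by rewrite !scaleE; field.
Qed.

Lemma hessian_slice t x i j : hessian (u t) x i j = 'D_(0, delta_mx 0 i) (Ux j) (t, x).
Proof.
rewrite mxE; have -> : 'D_(delta_mx 0 j) (u t) = (fun z => Ux j (t, z)).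
  by apply/funext => z; rewrite /Ux -derive_space.
exact: derive_space.
Qed.

Lemma grad_slice t x j : grad (u t) x 0 j = Ux j (t, x).
Proof. by rewrite mxE /Ux -derive_space. Qed.

Lemma is_derive_slice x s : x != 0 -> is_derive s 1 (u ^~ x) (u s x * K (s, x)).
Proof.
move=> x0; have := is_derive_time (@joint_differentiable (s, x) x0).
by rewrite /K /= -/(U (s, x)) mulrC divfK// lt0r_neq0// joint_gt0.
Qed.

Lemma is_derive_ln_slice x s : x != 0 -> is_derive s 1 (fun s => ln (u s x)) (K (s, x)).
Proof.
move=> x0; have d := is_derive_slice s x0; have u0 := joint_gt0 (x0 : (s, x).2 != 0).
apply: is_derive_eq (is_derive1_comp (is_derive1_ln u0) d) _.
by rewrite mulKf// lt0r_neq0.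
Qed.

Lemma is_derive_inv_slice x s : x != 0 ->
  is_derive s 1 (fun s => (u s x)^-1) (- (K (s, x) / u s x)).
Proof.
move=> x0; have d := is_derive_slice s x0.
have u0 : u s x != 0 by exact/lt0r_neq0/(@joint_gt0 (s, x)).
apply: is_derive_eq (is_deriveV u0 d) _.
by rewrite !scaleE; field.
Qed.

Lemma is_derive_log_rate x s : x != 0 ->
  is_derive s 1 (fun s => K (s, x)) ('D_(1, 0) K (s, x)).
Proof. by move=> x0; exact/is_derive_time/log_rate_differentiable. Qed.

Lemma touching_maximizer x c s : touching (u s) y x c ->
  [/\ X s = x, w s y = c%:E & wy s = c].
Proof.
move=> h; rewrite /maximizer /polar_path /polar_grad (S1_polar_subdiff (uS1 s) h).
by rewrite (S1_polar_touching (uS1 s) h) (xget_unique 0 (erefl x : [set x] x)).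
Qed.

(** Attainment is an open condition in time, so identities valid at attained times can be
    differentiated. *)
Lemma attained_near s : attained s -> \forall r \near s, attained r.
Proof.
move=> gs; have := touching_near uS1 joint_continuous gs ltr01.
apply: filterS => r [x [c [h _]]].
by rewrite /attained; have [-> _ ->] := touching_maximizer h.
Qed.

(** Persistence holds with arbitrarily small radius, and the nearby touching point is the maximizer
    by uniqueness. *)
Lemma maximizer_continuous s : attained s -> {for s, continuous X}.
Proof.
move=> gs; apply/cvgrPdist_lt => e e0.
have := touching_near uS1 joint_continuous gs e0.
apply: filterS => r [x [c [h xe]]].
by have [-> _ _] := touching_maximizer h; rewrite distrC.
Qed.

Lemma maximizer_neq0 s : attained s -> X s != 0.
Proof. exact: touching_neq0 (S1_ge0 (uS1 s)). Qed.

Lemma attained_gradE s j : attained s -> y 0 j = wy s * Ux j (s, X s).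
Proof. by move=> gs; rewrite -{1}(S1_touching_grad (uS1 s) gs) mxE grad_slice. Qed.

Local Notation H s := (hessian (u s) (X s)).

Lemma hessian_unitmx s : attained s -> H s \in unitmx.
Proof.
move=> gs; apply: posdef_unitmx; have [_ _] := uS2 s.
by move/(_ (X s) (maximizer_neq0 gs)).
Qed.

(** The solution [d] of [d *m H s = - U dK], the linearized Euler equation in row-vector form. *)
Definition maximizer_velocity s := - (u s (X s) *: (dK (s, X s) *m invmx (H s))).

Lemma is_derive_maximizer s : attained s -> is_derive s 1 X (maximizer_velocity s).
Proof.
move=> gs; have X0 := maximizer_neq0 gs; pose p := (s, X s).
pose l := dot (X s) y - 1.
have lE : l = wy s * U p.
  by case: gs => _ _; rewrite /l /joint /= => ->; rewrite addrAC subrr add0r.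
have [w0 _ _] := gs.
have l0 : l != 0 by rewrite lE mulf_neq0 ?lt0r_neq0// joint_gt0.
pose G j (q : R * 'rV[R]_n) := (dot q.2 y - 1) * Ux j q - U q * y 0 j.
(* [F] is the Euler equation [G] multiplied by the inverse of its linearization
   [l *: H s] in the space variable. *)
pose F k : R * 'rV[R]_n -> R := l^-1 *: \sum_j (invmx (H s) j k *: (G j : _ -> R^o)).
have dG j : differentiable (G j) p.
  apply: differentiableB; apply: differentiableM.
  - by have [] := is_diff_dot y p.
  - exact: derive_joint_differentiable.
  - exact: joint_differentiable.
  - exact: differentiable_cst.
have dF k : differentiable (F k) p.
  by apply: differentiableZ; apply: differentiable_sum => j; exact: differentiableZ.
(* By the Euler equation, [dot d y * Ux j p] and the [y 0 j] multiple of the space derivative of [U]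
   coincide and cancel; [l = wy s * U p] then factors out of the rest. *)
have dGE j (h : R) (d : 'rV[R]_n) :
    'D_(h, d) (G j) p = l * ((d *m H s) 0 j + h * (U p * dK p 0 j)).
  have a1 := is_derive_dot y p h d.
  have dUx : differentiable (Ux j) p by exact: derive_joint_differentiable.
  have dU : differentiable U p by exact: joint_differentiable.
  have a2 := derivableP (@diff_derivable _ _ _ (Ux j) p (h, d) dUx).
  have a3 := derivableP (@diff_derivable _ _ _ U p (h, d) dU).
  have a4 := is_deriveM a3 (is_derive_cst (y 0 j) p (h, d)).
  have a5 := is_deriveB (is_deriveM a1 a2) a4.
  apply: etrans (derive_val (is_derive := a5)) _.
  rewrite (derive_decomp _ _ dUx) (derive_decomp _ _ dU).
  have -> : dot d y = wy s * \sum_i d 0 i * Ux i p.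
    rewrite dotE mulr_sumr; apply: eq_bigr => i _.
    by rewrite (attained_gradE i gs) mulrCA.
  have -> : (d *m H s) 0 j = \sum_i d 0 i * 'D_(0, delta_mx 0 i) (Ux j) p.
    by rewrite mxE; apply: eq_bigr => i _; rewrite hessian_slice.
  rewrite (@grad_log_rateE p _ X0) (attained_gradE j gs) !scaleE -/l lE mulr0.
  have U0 : U p != 0 by exact/lt0r_neq0/joint_gt0.
  rewrite /cst -/p -['D_(1, 0) U p]/(Ut p).
  rewrite -[\sum_i d 0 i * 'D_(0, delta_mx 0 i) U p]/(\sum_i d 0 i * Ux i p).
  move: (\sum_i d 0 i * Ux i p) (\sum_i d 0 i * _) ('D_(1, 0) (Ux j) p) => S T D.
  move: (Ux j p) (Ut p) (U p) U0 => a b c c0.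
  by field.
rewrite -[maximizer_velocity s]/(- (u s (X s) *: (dK (s, X s) *m invmx (H s)))).
apply: (implicit_derivable dF); last exact: maximizer_continuous.
  move=> k h d; rewrite -deriveE//.
  have a j := derivableP (@diff_derivable _ _ _ (G j) p (h, d) (dG j)).
  have a1 := is_derive_sum (fun j => is_deriveZ (invmx (H s) j k) (a j)).
  apply: etrans (derive_val (is_derive := is_deriveZ l^-1 a1)) _.
  rewrite scaleE mulr_sumr.
  transitivity (\sum_j ((d *m H s) 0 j + h * (U p * dK p 0 j)) * invmx (H s) j k).
    apply: eq_bigr => j _; rewrite scaleE dGE [_ * (l * _)]mulrCA mulKf//.
    exact: mulrC.
  under eq_bigr do rewrite mulrDl.
  rewrite big_split/= addrC; congr (_ + _).
    rewrite mxE [X in U p * X]mxE !mulr_sumr; apply: eq_bigr => j _.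
    by rewrite -!mulrA.
  transitivity ((d *m H s *m invmx (H s)) 0 k); first by rewrite [RHS]mxE.
  by rewrite -mulmxA mulmxV ?mulmx1// hessian_unitmx.
(* The Euler equation holds at all nearby times, so every [F k] vanishes along the curve. *)
have := attained_near gs; apply: filterS => r gr k.
have G0 j : G j (r, X r) = 0.
  rewrite /G /= (attained_gradE j gr).
  have [_ _ ->] := gr.
  by rewrite [1 + _]addrC addrK /joint /=; ring.
rewrite -[LHS]/(l^-1 * (\sum_j (invmx (H s) j k *: (G j : _ -> R^o))) (r, X r)).
rewrite fct_sumE big1 ?mulr0// => j _.
by rewrite -[LHS]/(invmx (H s) j k * G j (r, X r)) G0 mulr0.
Qed.

Definition rate_deriv s := 'D_(1, 0) K (s, X s) -
  u s (X s) * dot (dK (s, X s)) (dK (s, X s) *m invmx (H s)).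

Lemma is_derive_rate s : attained s -> is_derive s 1 rate (rate_deriv s).
Proof.
move=> gs; have X0 := maximizer_neq0 gs.
have := is_derive_along (@log_rate_differentiable (s, X s) X0) (is_derive_maximizer gs).
rewrite (derive_decomp _ _ (@log_rate_differentiable (s, X s) X0)) mul1r.
rewrite (_ : \sum_i _ = dot (maximizer_velocity s) (dK (s, X s))); last first.
  by rewrite dotE; apply: eq_bigr => i _; rewrite [dK _ 0 i]mxE.
by rewrite /maximizer_velocity -scaleN1r !dotZl mulN1r dotC.
Qed.

(* Envelope theorem: the motion of the maximizer does not contribute. *)
Lemma is_derive_polar_path s : attained s -> is_derive s 1 wy (- (wy s * rate s)).
Proof.
move=> gs; have X0 := maximizer_neq0 gs; pose p := (s, X s).
have U0 : U p != 0 by exact/lt0r_neq0/joint_gt0.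
pose M (q : R * 'rV[R]_n) := (dot q.2 y - 1) * (U q)^-1.
have dM : differentiable M p.
  apply: differentiableM.
    by have [] := is_diff_dot y p.
  by apply: differentiableV => //; exact: joint_differentiable.
have e : \forall r \near s, M (r, X r) = wy r.
  apply: filterS (attained_near gs) => r gr; have [_ _ e] := gr.
  rewrite /M /= e addrAC subrr add0r mulfK//.
  exact/lt0r_neq0/(@joint_gt0 (r, X r))/maximizer_neq0.
apply: near_eq_is_derive e _.
apply: is_derive_eq (is_derive_along dM (is_derive_maximizer gs)) _.
set v := maximizer_velocity s.
have a1 := is_derive_dot y p 1 (v).
have U_diff : differentiable U p by exact: joint_differentiable.
have dU := @diff_derivable _ _ _ U p (1, v) U_diff.
have a2 := DeriveDef (derivableV U0 dU) (deriveV U0 dU).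
apply: etrans (derive_val (is_derive := is_deriveM a1 a2)) _.
rewrite (derive_decomp _ _ U_diff) mul1r !scaleE.
(* The Euler equation makes the two contributions of [v] to the derivative of [M] cancel. *)
have -> : dot (v) y = wy s * \sum_i v 0 i * Ux i p.
  rewrite dotE mulr_sumr; apply: eq_bigr => i _.
  by rewrite (attained_gradE i gs) mulrCA.
have [_ _ ->] := gs; rewrite /rate /K -/p -['D_(1, 0) U p]/(Ut p) -[u s (X s)]/(U p).
rewrite -[\sum_i v 0 i * 'D_(0, delta_mx 0 i) U p]/(\sum_i v 0 i * Ux i p).
move: (\sum_i v 0 i * Ux i p) (Ut p) (U p) U0 => S a c c0.
by field.
Qed.

Lemma is_derive_ln_polar_path s : attained s ->
  is_derive s 1 (fun s => ln (wy s)) (- rate s).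
Proof.
move=> gs; have [w0 _ _] := gs.
apply: is_derive_eq (is_derive1_comp (is_derive1_ln w0) (is_derive_polar_path gs)) _.
by rewrite mulrN mulKf// lt0r_neq0.
Qed.

(** Identifies the gradient in the statement with [dK]; the time derivative is computed only off the
    origin, so equality near [x] is used. *)
Lemma grad_derive_ln x t : x != 0 ->
  grad (fun z => derive1 (fun s => ln (u s z)) t) x = dK (t, x).
Proof.
move=> x0; apply/rowP => i; rewrite [LHS]mxE [RHS]mxE.
apply: etrans (derive_space K t x (delta_mx 0 i)); apply: near_eq_derive.
apply: filterS (near_neq0 x0) => z z0.
by rewrite derive1E (derive_val (is_derive := is_derive_ln_slice t z0)).
Qed.

Lemma grad_log_derive x t : x != 0 ->
  grad (fun z => derive1 (fun s => u s z) t / u t z) x = dK (t, x).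
Proof.
move=> x0; apply/rowP => i; rewrite [LHS]mxE [RHS]mxE.
apply: etrans (derive_space K t x (delta_mx 0 i)); apply: near_eq_derive.
apply: filterS (near_neq0 x0) => z z0.
rewrite derive1E (derive_val (is_derive := is_derive_slice t z0)) mulrC mulKf//.
exact/lt0r_neq0/(@joint_gt0 (t, z)).
Qed.

Lemma attained_of_not_linear t : ~ linear_on_segment (w t) y -> attained t.
Proof.
move=> /(not_linear_touching (uS1 t))[x h].
by rewrite /attained; have [-> _ ->] := touching_maximizer h.
Qed.

End Variation.

(** * The logarithmic and determinant forms of the second variation *)

Theorem theorem5p4 (R : realType) (n : nat) (u : R -> 'rV[R]_n -> R)
    (uC2 : C2_on [set p : R * 'rV[R]_n | p.2 != 0] (fun p => u p.1 p.2))
    (uS2 : forall t, S2 (EFin \o u t)) :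
  let w (t : R) : 'rV[R]_n -> \bar R := polar (EFin \o u t) in
  forall (t : R) (y : 'rV[R]_n), ~ linear_on_segment (w t) y ->
  let wy (s : R) : R := fine (w s y) in
  let log_wy (s : R) : R := ln (wy s) in
  let x := polar_grad (w t) y in
  let ux (s : R) : R := u s x in
  let H := hessian (u t) x in
  let dlog := grad (fun z => derive1 (fun s => ln (u s z)) t) x in
  let b := u t x *: grad (fun z => derive1 (fun s => u s z) t / u t z) x in
  [/\ polar_differentiable (w t) y,
      \forall s \near t, (0 < w s y < +oo)%E,
      twice_derivable log_wy t /\
      derive1n 2 log_wy t = - derive1n 2 (fun s => ln (ux s)) t
                      + u t x * dot dlog (invmx H *m dlog^T)^T &
      twice_derivable wy t /\
      derive1n 2 wy t / wy t =
        - (u t x * \det H)^-1 *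
          \det (block_mx (- (u t x) ^+ 2 * derive1n 2 (fun s => (ux s)^-1) t)%:M b
                         b^T H : 'M[R]_(1 + n))].
Proof.
move=> w t y nlin wy log_wy x ux H dlog b.
have uS1 s : S1 (EFin \o u s) by have [] := uS2 s.
have gt := attained_of_not_linear uS2 nlin.
have x0 : x != 0 := maximizer_neq0 uS2 gt.
have near_gt := attained_near uC2 uS2 gt.
have u0 : u t x != 0 by exact/lt0r_neq0/(S1_gt0 (uS1 t)).
have [_ wE _] := touching_maximizer uS2 gt.
have [w0 _ _] := gt.
pose K := log_rate u; pose dK := grad_log_rate u (t, x).
have dlogE : dlog = dK by exact: grad_derive_ln.
have bE : b = u t x *: dK by rewrite /b grad_log_derive.
pose q := dot dK (dK *m invmx H).
(* The column-vector form of the statement and the row-vector form [q] agree by symmetry of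
   [dot]. *)
have qE : dot dlog (invmx H *m dlog^T)^T = q.
  by rewrite /q [RHS]dotC /dot trmxK dlogE mulmxA.
pose Kt := 'D_(1, 0) K (t, x).
have [_ ln_u2] : twice_derivable (fun s => ln (ux s)) t /\
    derive1n 2 (fun s => ln (ux s)) t = Kt.
  apply: (@twice_derivable_near _ _ (fun s => K (s, x))).
    by near=> s; exact: is_derive_ln_slice.
  exact: is_derive_log_rate.
have [_ inv_u2] : twice_derivable (fun s => (ux s)^-1) t /\
    derive1n 2 (fun s => (ux s)^-1) t = - (Kt - K (t, x) ^+ 2) / u t x.
  apply: (@twice_derivable_near _ _ (fun s => - (K (s, x) / u s x))).
    by near=> s; exact: is_derive_inv_slice.
  have dK1 := is_derive_log_rate uC2 uS2 t x0.
  have dV := is_derive_inv_slice uC2 uS2 t x0.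
  apply: is_derive_eq (is_deriveN (is_deriveM dK1 dV)) _.
  rewrite !scaleE -/K -/Kt; set k := Kt; set l := K (t, x).
  by move: (u t x) u0 => v v0; field.
have k'E : rate_deriv u y t = Kt - u t x * q by [].
split.
- split; first by rewrite /dom /w /= wE ltry.
  exists x; exact (S1_polar_subdiff (uS1 t) gt).
- apply: filterS near_gt => s gs.
  have [_ ws _] := touching_maximizer uS2 gs.
  by have [ws0 _ _] := gs; rewrite /w ws lte_fin ws0 ltry.
- rewrite ln_u2 qE.
  have -> : - Kt + u t x * q = - rate_deriv u y t by rewrite k'E opprB addrC.
  apply: (@twice_derivable_near _ _ (fun s => - rate u y s)).
    by apply: filterS near_gt => s; exact: is_derive_ln_polar_path.
  by apply: is_deriveN; exact: is_derive_rate.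
(* Differentiate [wy' = - wy * rate] once more and substitute it again. *)
have [tw wy2] : twice_derivable wy t /\
    derive1n 2 wy t = wy t * (rate u y t ^+ 2 - rate_deriv u y t).
  apply: (@twice_derivable_near _ _ (fun s => - (wy s * rate u y s))).
    by apply: filterS near_gt => s; exact: is_derive_polar_path.
  have dw := is_derive_polar_path uC2 uS2 gt.
  have dr := is_derive_rate uC2 uS2 gt.
  apply: is_derive_eq (is_deriveN (is_deriveM dw dr)) _.
  by rewrite !scaleE -[wy t]/(polar_path u y t); ring.
split; first exact: tw.
have uH : H \in unitmx by exact: hessian_unitmx gt.
have dH : \det H != 0 by move: uH; rewrite unitmxE unitfE.
have det11 (M : 'M[R]_1) : \det M = M 0 0.
  by rewrite {1}[M]mx11_scalar det_scalar1.
have bb : (b *m invmx H *m b^T) 0 0 = u t x ^+ 2 * q.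
  rewrite bE linearZ /= -!scalemxAl -scalemxAr scalerA mxE expr2; congr (_ * _).
  by rewrite /q dotC.
have sub00 (v : R) (M : 'M[R]_1) : (v%:M - M) 0 0 = v - M 0 0.
  by rewrite !mxE eqxx mulr1n.
rewrite wy2 inv_u2 (det_block_schur _ _ _ uH) det11 sub00 bb k'E.
(* Here [a], [v], [D], [r], [k], [l] stand for [wy t], [u t x], [\det H], [q], [Kt] and [K (t, x)];
   the factor before [D] on the right is the scalar Schur complement of [H]. *)
have algebra (a v D r k l : R) : a != 0 -> v != 0 -> D != 0 ->
    a * (l ^+ 2 - (k - v * r)) / a =
    - (v * D)^-1 * ((- v ^+ 2 * (- (k - l ^+ 2) / v) - v ^+ 2 * r) * D).
  by move=> a0 v0 D0; field; rewrite v0 D0 a0.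
exact: (algebra _ _ _ _ _ _ (lt0r_neq0 w0) u0 dH).
Unshelve. all: by end_near. Qed.
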